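(* Let $r\ge 2$ and let $F$ be an $r$-graph with $e(F)\ge 2$ and $\frac{v(F)-r}{e(F)-1}<r$. Then for any $p=p(n)\ge n^{-\frac{v(F)-r}{e(F)-1}}$, asymptotically almost surely \[\mathrm{ex}(G_{n,p}^r,F)\ge n^{r-\frac{v(F)-r}{e(F)-1}-o(1)}\left(p\, n^{\frac{v(F)-r}{e(F)-1}}\right)^{\frac{s(F)}{e(F)-1+s(F)}}.\]
   Context: An $r$-graph is an $r$-uniform hypergraph; $v(H)$ and $e(H)$ denote its numbers of vertices and edges. A homomorphism from an $r$-graph $F$ to an $r$-graph $H$ is a map $\phi:V(F)\to V(H)$ such that $\phi(e)$ is an edge of $H$ for every edge $e$ of $F$; $\hom(F,H)$ is the number of homomorphisms and $t_F(H)=\hom(F,H)/v(H)^{v(F)}$ is the homomorphism density. $K_r^r$ denotes the $r$-graph consisting of a single edge. For an $r$-graph $F$, define $s(F):=\sup\{s:\ \exists\, r\text{-graph } H \text{ with } t_F(H)=t_{K_r^r}(H)^{s+e(F)}>0\}$. $G_{n,p}^r$ is the random $r$-graph on $n$ vertices in which each $r$-set is an edge independently with probability $p$. $\mathrm{ex}(G,F)$ is the maximum number of edges in an $F$-free subgraph of $G$. ''Asymptotically almost surely'' means with probability tending to $1$ as $n\to\infty$; $o(1)$ denotes a quantity tending to $0$ as $n\to\infty$. *)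

(* Defs.v *)
From HB Require Import structures.
From mathcomp Require Import all_boot all_order all_algebra.
From mathcomp Require Import all_classical all_reals all_analysis.

Set Implicit Arguments.
Unset Strict Implicit.
Unset Printing Implicit Defensive.

Import Order.TTheory GRing.Theory Num.Theory.
Import numFieldNormedType.Exports.

Local Open Scope classical_set_scope.
Local Open Scope ring_scope.

Record r_graph (r : nat) (V : finType) := RGraph {
  edges : {set {set V}};
  _ : [forall e in edges, #|e| == r]
}.

HB.instance Definition _ r V := [isSub for @edges r V].
HB.instance Definition _ r V := [Finite of r_graph r V by <:].

Definition nb_vertices r (V : finType) (F : r_graph r V) : nat := #|V|.
Definition nb_edges r (V : finType) (F : r_graph r V) : nat := #|edges F|.

Definition is_hom r (V W : finType) (F : r_graph r V) (H : r_graph r W)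
    (phi : {ffun V -> W}) : bool :=
  [forall e in edges F, (phi @: e)%SET \in edges H].

Definition hom_count r (V W : finType) (F : r_graph r V) (H : r_graph r W) : nat :=
  #|[set phi : {ffun V -> W} | is_hom F H phi]%SET|.

Definition hom_density (R : realType) r (V W : finType)
    (F : r_graph r V) (H : r_graph r W) : R :=
  (hom_count F H)%:R / (nb_vertices H)%:R ^+ nb_vertices F.

Lemma single_edge_subproof (r : nat) :
  [forall e in [set [set: 'I_r]]%SET, #|e : {set 'I_r}| == r].
Proof. by apply/forall_inP => e /set1P ->; rewrite cardsT card_ord. Qed.

Definition single_edge (r : nat) : r_graph r 'I_r :=
  RGraph (single_edge_subproof r).

(* The supremum is taken in the extended reals because it is infinite when F
   is not r-partite. *)
Definition sidorenko_gap (R : realType) r (V : finType) (F : r_graph r V)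
    : \bar R :=
  ereal_sup [set s%:E | s in
    [set s : R | exists (W : finType) (H : r_graph r W),
      hom_density R F H
        = hom_density R (single_edge r) H `^ (s + (nb_edges F)%:R)
      /\ 0 < hom_density R F H]].

(* s(F) / (e(F) - 1 + s(F)), read as its limit 1 when s(F) = +oo. The value
   -oo does not arise when r >= 2 and F has an edge: H = F contributes a real
   number to the supremum. *)
Definition gap_exponent (R : realType) r (V : finType) (F : r_graph r V) : R :=
  match sidorenko_gap R F with
  | s%:E => s / ((nb_edges F)%:R - 1 + s)
  | +oo%E => 1
  | -oo%E => 0
  end.

(* A copy of F in G is a not necessarily induced subgraph isomorphic to F,
   i.e. the image of an injective homomorphism. *)
Definition is_free r (V W : finType) (F : r_graph r V) (G : r_graph r W) : bool :=
  [forall phi : {ffun V -> W}, is_hom F G phi ==> ~~ injectiveb phi].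

(* Subgraphs are spanning: they are given by subsets of the edge set. *)
Definition turan_ex r (V W : finType) (G : r_graph r W) (F : r_graph r V) : nat :=
  \max_(G' : r_graph r W | (edges G' \subset edges G) && is_free F G')
     nb_edges G'.

(* Law of the random r-graph on n vertices: the product over all r-sets of
   Bernoulli(p) weights. *)
Definition Gnp_prob (R : realType) (r n : nat) (p : R)
    (A : {set r_graph r 'I_n}) : R :=
  \sum_(G in A) \prod_(e : {set 'I_n} | #|e| == r)
     (if e \in edges G then p else 1 - p).

(* (v(F) - r) / (e(F) - 1) *)
Definition threshold_exponent (R : realType) r (V : finType) (F : r_graph r V)
    : R :=
  ((nb_vertices F)%:R - r%:R) / ((nb_edges F)%:R - 1).

(* Main.v *)
(* Let H satisfy t_F(H) = t_K(H)^(s + e(F)), and put a = t_K(H). A uniformly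
   random map from [n] to the tensor power H^N pulls H^N back to an r-graph on
   [n] which contains each r-set with probability a^N and each copy of F with
   probability a^(N (s + e(F))). By averaging, some r-graph Gamma on [n] has at
   least C(n, r) a^N / 2 edges and at most 1 / lambda copies of F per edge,
   where lambda is half the ratio of the two expectations. In the intersection
   of G_{n,p} with Gamma the edges concentrate (Chebyshev) and the copies of F
   number at most half as many (Markov), so deleting one
   edge from each copy leaves an F-free graph of the right size. Here N is
   chosen so that a^N is about
   (p n^m)^(- (e(F) - 1) / (s + e(F) - 1)) up to n^{o(1)}, with
   m = (v(F) - r) / (e(F) - 1). Letting s tend to s(F), and the n^{o(1)} loss
   tend to 1 along a diagonal sequence, gives the theorem. If s(F) <= 0, random
   set systems of density 1/2 play the part of the pullbacks, with s = 0. *)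

Require Import Defs.
From HB Require Import structures.
From mathcomp Require Import all_boot all_order all_algebra.
From mathcomp Require Import all_classical all_reals all_analysis.
From mathcomp Require Import ring lra zify.

Set Implicit Arguments.
Unset Strict Implicit.
Unset Printing Implicit Defensive.

Import Order.TTheory GRing.Theory Num.Theory.
Import numFieldNormedType.Exports.

Local Open Scope ring_scope.

(** * Counting extensions of maps; uniform parts and labelled copies *)

(** A map on [V] extends along [phi] by values forced on the image of [phi] and free elsewhere, so
    every map has the same number of extensions. Both sides are multiplied out to avoid a
    subtraction in the exponent. *)
Lemma card_ffun_comp_inj (T V W : finType) (phi : V -> T)
    (A : {set {ffun V -> W}}) : injective phi ->
  (#|[set chi : {ffun T -> W} | [ffun v => chi (phi v)] \in A]| * #|W| ^ #|V|
   = #|A| * #|W| ^ #|T|)%N.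
Proof.
move=> phi_inj; set B := [set chi | _]%SET.
have fiber (psi : {ffun V -> W}) :
  (#|[set chi : {ffun T -> W} | [ffun v => chi (phi v)] == psi]| * #|W| ^ #|V|
   = #|W| ^ #|T|)%N.
  pose D t : pred W := [pred w | [forall v, (phi v == t) ==> (w == psi v)]].
  have -> : #|[set chi : {ffun T -> W} | [ffun v => chi (phi v)] == psi]|
            = #|family D|.
    apply: eq_card => chi; rewrite inE; apply/eqP/familyP => [chiE t|chiD].
      apply/forallP => v; apply/implyP => /eqP <-; apply/eqP.
      by rewrite -chiE ffunE.
    apply/ffunP => v; rewrite ffunE; apply/eqP.
    by have /forallP/(_ v) := chiD (phi v); rewrite eqxx.
  have DE t : #|D t| = (if t \in codom phi then 1 else #|W|)%N.
    case: ifPn => [/codomP[v ->]|tNphi].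
      rewrite -(card1 (psi v)); apply: eq_card => w; rewrite !inE.
      apply/forallP/eqP => [/(_ v)|-> u]; first by rewrite eqxx => /eqP.
      by apply/implyP => /eqP/phi_inj ->.
    apply: eq_card => w; rewrite !inE; apply/forallP => v.
    by apply/implyP => /eqP phiv; rewrite -phiv codom_f in tNphi.
  have -> : #|family D| = (\prod_t #|D t|)%N.
    by rewrite card_family foldrE big_map big_enum.
  rewrite (bigID [in codom phi]) /= big1 => [|t tphi]; last by rewrite DE tphi.
  rewrite (eq_bigr (fun=> #|W|)) => [|t /negPf tphi]; last by rewrite DE tphi.
  rewrite prod_nat_const mul1n -(card_codom phi_inj) -expnD addnC.
  by rewrite -(cardC [in codom phi]).
transitivity (\sum_(psi in A)
  #|[set chi : {ffun T -> W} | [ffun v => chi (phi v)] == psi]| * #|W| ^ #|V|)%N.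
  rewrite -big_distrl /=; congr (_ * _)%N.
  rewrite -sum1_card (partition_big (fun chi : {ffun T -> W} =>
    [ffun v => chi (phi v)]) [in A]) /= => [|chi]; last by rewrite inE.
  apply: eq_bigr => psi psiA; rewrite -sum1_card; apply: eq_bigl => chi.
  by rewrite !inE; case: eqP => [->|_]; rewrite ?andbT ?andbF.
by rewrite (eq_bigr _ (fun psi _ => fiber psi)) sum_nat_const.
Qed.

Lemma card_edge r (V : finType) (F : r_graph r V) (f : {set V}) :
  f \in edges F -> #|f| = r.
Proof.
by case: F => E /= /forall_inP rE fF; apply/eqP/rE.
Qed.

Fact uniform_part_subproof r (V : finType) (S : {set {set V}}) :
  [forall e in [set e in S | #|e| == r]%SET, #|e| == r].
Proof. by apply/forall_inP => e; rewrite inE => /andP[]. Qed.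

(** Needed because a pullback of an r-graph under a non-injective map may contain sets of more than
    [r] vertices. *)
Definition uniform_part r (V : finType) (S : {set {set V}}) : r_graph r V :=
  RGraph (uniform_part_subproof r S).

Lemma mem_uniform_part r (V : finType) (S : {set {set V}}) (e : {set V}) :
  (e \in edges (uniform_part r S)) = (e \in S) && (#|e| == r).
Proof. by rewrite inE. Qed.

(** Labelled copies: a subgraph isomorphic to [F] is counted once for each automorphism of [F]. *)
Definition copies r (V W : finType) (F : r_graph r V) (G : r_graph r W) :
  {set {ffun V -> W}} := [set phi | is_hom F G phi && injectiveb phi]%SET.

Lemma card_ord_ffun_forall (T : finType) (N : nat) (P : pred T) :
  #|[set t : {ffun 'I_N -> T} | [forall i, P (t i)]]%SET|
  = (#|[set x | P x]%SET| ^ N)%N.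
Proof.
rewrite -[X in (_ ^ X)%N]card_ord -card_ffun_on; apply: eq_card => t.
by rewrite inE; apply: eq_forallb => i; rewrite !inE.
Qed.

Lemma sum_le_ex (R : realDomainType) (T : finType) (f : T -> R) (c : R) :
  (0 < #|T|)%N -> c * #|T|%:R <= \sum_t f t -> exists t, c <= f t.
Proof.
move=> T0 le_sum; apply/existsP; apply: contraLR le_sum.
rewrite negb_exists => /forallP f_lt; rewrite -ltNge mulr_natr -sumr_const.
have [t0 _] := card_gt0P T0.
rewrite (bigD1 t0) //= [ltRHS](bigD1 t0) //= ltr_leD //.
  by rewrite ltNge f_lt.
by apply: ler_sum => t _; rewrite leNgt; apply/negP => /ltW; apply/negP/f_lt.
Qed.

(** * Random set systems, their powers, and averaging *)

Section RandomSubhypergraph.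
Variables (R : realType) (r : nat) (V U : finType) (F : r_graph r V).

(* [A t] is a random set system when [t] is drawn uniformly from [T]; both
   probabilities are multiplied by [#|T|]. *)
Definition random_system (T : finType) (A : T -> {set {set U}}) (a b : R) :=
  [/\ (0 < #|T|)%N,
      forall e : {set U}, #|e| = r ->
        #|[set t | e \in A t]%SET|%:R = a * #|T|%:R
    & forall phi : {ffun V -> U}, injective phi ->
        #|[set t | [forall f in edges F, (phi @: f)%SET \in A t]]%SET|%:R
        = b * #|T|%:R].

(** Intersecting [N] independent samples multiplies probabilities. For pullbacks of [H] this
    replaces the tensor power of [H], which is never built. *)
Lemma random_system_exp (T : finType) (A : T -> {set {set U}}) (a b : R) N :
  random_system A a b ->
  random_system (fun t : {ffun 'I_N -> T} =>
    [set e | [forall i, e \in A (t i)]]%SET) (a ^+ N) (b ^+ N).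
Proof.
move=> [T0 Aa Ab]; rewrite /random_system card_ffun card_ord.
rewrite expn_gt0 T0; split=> // [e er|phi phi_inj].
  under eq_finset do rewrite inE.
  rewrite (card_ord_ffun_forall _ (fun x => e \in A x)).
  by rewrite !natrX Aa // exprMn.
rewrite natrX -exprMn -(Ab phi) // -natrX -(card_ord_ffun_forall _ (fun x =>
    [forall f in edges F, (phi @: f)%SET \in A x])); congr _%:R.
apply: eq_card => t; rewrite !inE; apply/forall_inP/forallP.
  move=> At i; apply/forall_inP => f fF.
  by have := At f fF; rewrite inE => /forallP/(_ i).
by move=> At f fF; rewrite inE; apply/forallP => i; apply: (forall_inP (At i)).
Qed.

(** First moment method for edges minus [lam] times copies; some sample does at least as well as the
    mean. The number of injective maps is bounded by that of all maps. *)
Lemma random_system_ex (T : finType) (A : T -> {set {set U}}) (a b lam : R) :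
  random_system A a b -> 0 <= b -> 0 <= lam ->
  exists G : r_graph r U,
    'C(#|U|, r)%:R * a - lam * (#|U| ^ #|V|)%:R * b
    <= (nb_edges G)%:R - lam * #|copies F G|%:R.
Proof.
move=> [T0 Aa Ab] b0 lam0.
pose G t := uniform_part r (A t).
suff [t tP] : exists t, 'C(#|U|, r)%:R * a - lam * (#|U| ^ #|V|)%:R * b
    <= (nb_edges (G t))%:R - lam * #|copies F (G t)|%:R by exists (G t).
apply: sum_le_ex => //.
have edgesE t : (nb_edges (G t))%:R
    = \sum_(e : {set U} | #|e| == r) (e \in A t)%:R :> R.
  rewrite /nb_edges -sum1_card natr_sum big_mkcond [RHS]big_mkcond /=.
  apply: eq_bigr => e _; rewrite mem_uniform_part andbC.
  by case: (_ == r) => //=; case: (_ \in A t).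
have copiesE t : #|copies F (G t)|%:R
    = \sum_(phi : {ffun V -> U} | injectiveb phi)
        [forall f in edges F, (phi @: f)%SET \in A t]%:R :> R.
  rewrite -sum1_card natr_sum big_mkcond [RHS]big_mkcond /=.
  apply: eq_bigr => phi _; rewrite inE andbC.
  case: ifPn => [/andP[/injectiveP phi_inj phiF]|].
    rewrite (introT (injectiveP _) phi_inj).
    suff -> : [forall f in edges F, (phi @: f)%SET \in A t] by [].
    apply/forall_inP => f fF.
    by have := forall_inP phiF f fF; rewrite mem_uniform_part => /andP[].
  case: injectiveP => //= phi_inj; apply: contraNeq.
  rewrite eq_sym pnatr_eq0 eqb0 negbK => /forall_inP phiA; apply/forall_inP => f fF.
  by rewrite mem_uniform_part phiA //= card_imset // (card_edge fF).
rewrite sumrB -mulr_sumr (eq_bigr _ (fun t _ => edgesE t)).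
rewrite (eq_bigr _ (fun t _ => copiesE t)) exchange_big /=.
rewrite [X in _ <= _ - lam * X]exchange_big /= mulrBl; apply: lerB.
  rewrite (eq_bigr (fun=> a * #|T|%:R)) => [|e /eqP er].
    rewrite sumr_const -[X in _ <= _ *+ X]cardsE card_draws.
    by rewrite -[leRHS]mulr_natl mulrA.
  rewrite -(Aa e) // -sum1_card natr_sum [RHS]big_mkcond /=.
  by apply: eq_bigr => t _; rewrite inE; case: (_ \in _).
rewrite -!mulrA ler_wpM2l //.
rewrite (eq_bigr (fun=> b * #|T|%:R)) => [|phi /injectiveP phi_inj].
  rewrite sumr_const -[leLHS]mulr_natl ler_wpM2r ?mulr_ge0 //.
  by rewrite ler_nat -card_ffun max_card.
rewrite -(Ab phi) // -sum1_card natr_sum [RHS]big_mkcond /=.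
by apply: eq_bigr => t _; rewrite inE; case: [forall _ in _, _].
Qed.

Lemma single_edge_hom (W : finType) (H : r_graph r W)
    (phi : {ffun 'I_r -> W}) :
  is_hom (single_edge r) H phi = ((phi @: [set: 'I_r])%SET \in edges H).
Proof.
apply/forall_inP/idP => [phiH|phiH e /set1P -> //].
by apply: phiH; apply: set11.
Qed.

(** For a uniformly random [chi], the composite with the injection [phi] is a uniformly random map
    from [X] to [W], hence a homomorphism with probability the homomorphism density. *)
Lemma hom_pullback_count (W X : finType) (K : r_graph r X) (H : r_graph r W)
    (phi : {ffun X -> U}) : (0 < #|W|)%N -> injective phi ->
  #|[set chi : {ffun U -> W} |
     [forall f in edges K, (chi @: (phi @: f))%SET \in edges H]]%SET|%:R
  = hom_density R K H * #|{ffun U -> W}|%:R.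
Proof.
move=> W0 phi_inj.
have := card_ffun_comp_inj [set psi | is_hom K H psi]%SET phi_inj.
rewrite -/(hom_count K H) -(card_ffun U W) => /(congr1 (fun n => n%:R : R)).
rewrite !natrM natrX /hom_density /nb_vertices => cardE.
have nz : #|W|%:R ^+ #|X| != 0 :> R by rewrite expf_neq0 // pnatr_eq0 -lt0n.
apply: (mulIf nz); rewrite mulrAC divfK // -cardE.
congr (_%:R * _); apply: eq_card => chi; rewrite !inE.
apply: eq_forallb_in => f _; rewrite -imset_comp.
suff -> : ((chi \o phi) @: f = [ffun v => chi (phi v)] @: f)%SET by [].
by apply: eq_imset => x; rewrite ffunE.
Qed.

Lemma random_system_hom (W : finType) (H : r_graph r W) : (0 < #|W|)%N ->
  random_system (fun chi : {ffun U -> W} =>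
      [set e : {set U} | (chi @: e)%SET \in edges H]%SET)
    (hom_density R (single_edge r) H) (hom_density R F H).
Proof.
move=> W0; split=> [|e er|phi phi_inj].
- by rewrite card_ffun expn_gt0 W0.
(* An enumeration of [e] makes it a copy of the single edge. *)
- pose phi := [ffun i : 'I_r => enum_val (cast_ord (esym er) i)].
  have phi_inj : injective phi.
    by move=> i j; rewrite !ffunE => /enum_val_inj/cast_ord_inj.
  have phiE : (phi @: [set: 'I_r])%SET = e.
    apply/setP => x; apply/imsetP/idP => [[i _ ->]|xe].
      by rewrite ffunE enum_valP.
    exists (cast_ord er (enum_rank_in xe x)) => //.
    by rewrite ffunE cast_ordK enum_rankK_in.
  rewrite -(hom_pullback_count (single_edge r) H W0 phi_inj).
  congr _%:R; apply: eq_card => chi; rewrite !inE -{1}phiE.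
  apply/idP/forall_inP => [chiH f /set1P -> //|chiH].
  by apply: chiH; apply: set11.
rewrite -(hom_pullback_count F H W0 phi_inj); congr _%:R.
by apply: eq_card => chi; rewrite !inE; apply: eq_forallb => f; rewrite inE.
Qed.

(** Complementation turns supersets of [B] into subsets of its complement. *)
Lemma card_supset (X : finType) (B : {set X}) :
  #|[set S : {set X} | B \subset S]%SET|%:R
  = (2^-1) ^+ #|B| * #|{set X}|%:R :> R.
Proof.
have -> : #|[set S : {set X} | B \subset S]%SET| = (2 ^ #|(~: B)%SET|)%N.
  rewrite -card_powerset -(card_imset _ (@finset.setC_inj X)); apply: eq_card => S.
  rewrite powersetE; apply/imsetP/idP => [[S']|SB].
    by rewrite inE => BS' ->; rewrite finset.setCS.
  by exists (~: S)%SET; rewrite ?finset.setCK // inE -finset.setCS finset.setCK.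
rewrite -cardsT -powersetT card_powerset cardsT -(cardsC B) expnD natrM.
by rewrite mulrA !natrX -exprMn mulVf ?pnatr_eq0 // expr1n mul1r.
Qed.

Lemma imset_copy_inj (phi : {ffun V -> U}) : injective phi ->
  #|[set (phi @: (f : {set V}))%SET | f in edges F]%SET| = nb_edges F.
Proof. by move=> phi_inj; rewrite card_imset //; apply: imset_inj. Qed.

Lemma random_system_half :
  random_system (fun S : {set {set U}} => S) 2^-1 (2^-1 ^+ nb_edges F).
Proof.
split=> [|e er|phi phi_inj].
- by apply/card_gt0P; exists finset.set0.
- rewrite -[in RHS](expr1 (2^-1)) -[X in _ ^+ X](cards1 e) -card_supset.
  by congr _%:R; apply: eq_card => S; rewrite !inE finset.sub1set.
rewrite -(imset_copy_inj phi_inj) -card_supset; congr _%:R.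
apply: eq_card => S; rewrite !inE; apply/forall_inP/fintype.subsetP.
  by move=> FS e /imsetP[f fF ->]; apply: FS.
by move=> FS f fF; apply: FS; apply: imset_f.
Qed.

End RandomSubhypergraph.

(** * The random r-graph: moments, tail bounds and deletion *)

Lemma sum_r_graph_prod (R : comNzRingType) (r n : nat)
    (a b : {set 'I_n} -> R) :
  \sum_(G : r_graph r 'I_n)
    \prod_(e : {set 'I_n} | #|e| == r) (if e \in edges G then a e else b e)
  = \prod_(e : {set 'I_n} | #|e| == r) (a e + b e).
Proof.
(* Sets of size other than [r] get the factor 0 + 1, so that in the expansion over all set families
   only the r-uniform ones survive. *)
rewrite [RHS]big_mkcond (eq_bigr (fun e : {set 'I_n} =>
  (if #|e| == r then a e else 0) + (if #|e| == r then b e else 1))); last first.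
  by move=> e _; case: ifP => // _; rewrite add0r.
rewrite bigA_distr (bigID (fun J : {set {set 'I_n}} =>
  [forall e in J, #|e| == r])) /= [X in _ + X]big1 ?addr0; last first.
  move=> J; rewrite negb_forall_in => /exists_inP[e eJ er].
  by rewrite (bigD1 e) //= eJ (negPf er) mul0r.
rewrite (reindex_onto (@edges r 'I_n) (@uniform_part r 'I_n)); last first.
  move=> J /forall_inP rJ; apply/setP => e; rewrite mem_uniform_part.
  by apply: andb_idr => /rJ.
apply: congr_big => // [G|G _].
  case: G => E rE; rewrite rE /=; apply/esym/eqP/val_inj/setP => e /=.
  rewrite inE; apply: andb_idr => eE; exact: (forall_inP rE).
rewrite big_mkcond; apply: eq_bigr => e _.
by case: ifP => er; case: ifP => eG //; rewrite (card_edge eG) eqxx in er.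
Qed.

Lemma deviation_arith (R : realFieldType) (m z y t : R) : 0 < m ->
  (z - m) ^+ 2 < m ^+ 2 / 4 -> y < m / 4 -> z <= t + y -> m / 4 <= t.
Proof.
move=> m0 dev ym zt; suff : m / 2 < z by lra.
rewrite ltNge; apply/negP => zm; move: dev; apply/negP; rewrite -leNgt; nra.
Qed.

Section RandomGraph.
Variables (R : realType) (r n : nat) (p : R).
Hypothesis p01 : 0 <= p <= 1.

Let weight (G : r_graph r 'I_n) : R :=
  \prod_(e : {set 'I_n} | #|e| == r) (if e \in edges G then p else 1 - p).

Let weight_ge0 G : 0 <= weight G.
Proof.
have [p0 p1] := andP p01.
by apply: prodr_ge0 => e _; case: ifP => _ //; rewrite subr_ge0.
Qed.

(** Setting the weight of absence to 0 on [S] encodes the indicator; the sum then factors, with [p]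
    on [S] and p + (1 - p) elsewhere. *)
Lemma Gnp_expect_supset (S : {set {set 'I_n}}) :
  (forall e, e \in S -> #|e| = r) ->
  \sum_G weight G * (S \subset edges G)%:R = p ^+ #|S|.
Proof.
move=> rS; pose b e : R := if e \in S then 0 else 1 - p.
transitivity (\sum_(G : r_graph r 'I_n)
    \prod_(e : {set 'I_n} | #|e| == r) (if e \in edges G then p else b e)).
  apply: eq_bigr => G _; case: (boolP (S \subset _)) => [SG|].
    rewrite mulr1; apply: eq_bigr => e _; rewrite /b.
    by case: ifP => // eG; case: ifP => // eS; rewrite (fintype.subsetP SG) in eG.
  case/subsetPn => e eS eG; rewrite mulr0 (bigD1 e) /= ?rS ?eqxx //.
  by rewrite (negPf eG) /b eS mul0r.
rewrite sum_r_graph_prod -prodr_const big_mkcond [RHS]big_mkcond /=.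
apply: eq_bigr => e _; rewrite /b; case: (boolP (e \in S)) => [/rS ->|_].
  by rewrite eqxx addr0.
by case: ifP => // _; rewrite addrC subrK.
Qed.

Lemma Gnp_total : \sum_G weight G = 1.
Proof.
rewrite -[RHS](expr0 p) -(@cards0 {set 'I_n}) -Gnp_expect_supset.
  by apply: eq_bigr => G _; rewrite finset.sub0set mulr1.
by move=> e; rewrite inE.
Qed.

Lemma Gnp_prob_le1 (A : {set r_graph r 'I_n}) : Gnp_prob p A <= 1.
Proof.
rewrite -Gnp_total [leRHS](bigID [in A]) /= lerDl.
by apply: sumr_ge0 => G _; apply: weight_ge0.
Qed.

Lemma Gnp_prob_mono (A B : {set r_graph r 'I_n}) :
  A \subset B -> Gnp_prob p A <= Gnp_prob p B.
Proof.
move=> AB; rewrite /Gnp_prob big_mkcond [leRHS]big_mkcond /=.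
apply: ler_sum => G _; case: ifP => [/(fintype.subsetP AB) -> //|_].
by case: ifP => // _; apply: weight_ge0.
Qed.

Lemma Gnp_markov (X : r_graph r 'I_n -> R) (c : R) :
  (forall G, 0 <= X G) ->
  Gnp_prob p [set G | c <= X G]%SET * c <= \sum_G weight G * X G.
Proof.
move=> X0; rewrite /Gnp_prob big_mkcond mulr_suml; apply: ler_sum => G _.
rewrite inE; case: ifP => [cX|_]; last first.
  by rewrite mul0r mulr_ge0 // weight_ge0.
by rewrite ler_wpM2l // weight_ge0.
Qed.

Lemma Gnp_union_bound (A B1 B2 : {set r_graph r 'I_n}) :
  (forall G, G \notin B1 -> G \notin B2 -> G \in A) ->
  1 - Gnp_prob p B1 - Gnp_prob p B2 <= Gnp_prob p A.
Proof.
move=> B12A; rewrite -Gnp_total /Gnp_prob !lerBlDr.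
rewrite [X in _ <= _ + X + _]big_mkcond [X in _ <= _ + X]big_mkcond.
rewrite [X in _ <= X + _ + _]big_mkcond -!big_split; apply: ler_sum => G _ /=.
rewrite -/(weight G); have w0 := weight_ge0 G.
have := B12A G; case: (G \in A); case: (G \in B1); case: (G \in B2) => /= h;
  first [by lra | by move: (h isT isT)].
Qed.

Lemma Gnp_edges_variance (S : {set {set 'I_n}}) :
  (forall e, e \in S -> #|e| = r) ->
  \sum_G weight G * (#|(S :&: edges G)%SET|%:R - #|S|%:R * p) ^+ 2
  <= #|S|%:R * p.
Proof.
move=> rS; have [p0 p1] := andP p01.
have ZE G : #|(S :&: edges G)%SET|%:R
    = \sum_(e in S) (e \in edges G)%:R :> R.
  rewrite -sum1_card natr_sum big_mkcond [RHS]big_mkcond /=.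
  by apply: eq_bigr => e _; rewrite inE; case: (e \in S); case: (e \in edges G).
have EZ : \sum_G weight G * #|(S :&: edges G)%SET|%:R = #|S|%:R * p.
  under eq_bigr => G _ do rewrite ZE mulr_sumr.
  rewrite exchange_big /= mulr_natl -sumr_const; apply: eq_bigr => e eS.
  rewrite -[RHS]expr1 -(cards1 e) -Gnp_expect_supset.
    by apply: eq_bigr => G _; rewrite finset.sub1set.
  by move=> f /set1P ->; apply: rS.
have EZ2 : \sum_G weight G * #|(S :&: edges G)%SET|%:R ^+ 2
    <= #|S|%:R * p + (#|S|%:R * p) ^+ 2.
  under eq_bigr => G _ do rewrite ZE expr2 mulr_suml mulr_sumr.
  rewrite exchange_big /=.
  (* For fixed [e], the diagonal pair contributes [p] and every other pair [p ^+ 2]. Counting |S|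
     other pairs instead of |S| - 1 yields exactly the square of the mean. *)
  apply: (@le_trans _ _ (\sum_(e in S) (p + #|S|%:R * p ^+ 2))); last first.
    by rewrite sumr_const -mulr_natl le_eqVlt; apply/orP; left; apply/eqP; ring.
  apply: ler_sum => e eS.
  under eq_bigr => G _ do rewrite mulr_sumr mulr_sumr.
  rewrite exchange_big /= (bigD1 e) //=.
  have EI f : f \in S ->
      \sum_G weight G * ((e \in edges G)%:R * (f \in edges G)%:R)
      = p ^+ #|[set e; f]%SET|.
    move=> fS; rewrite -Gnp_expect_supset; last first.
      by move=> g /set2P[] ->; apply: rS.
    apply: eq_bigr => G _; rewrite finset.subUset !finset.sub1set.
    by case: (e \in _); case: (f \in _); rewrite /= ?mulr1 ?mulr0 ?mul0r.
  rewrite EI // finset.setUid cards1 expr1 lerD2l.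
  rewrite (eq_bigr (fun=> p ^+ 2)) => [|f /andP[fS fe]]; last first.
    by rewrite EI // cards2 eq_sym fe.
  rewrite mulr_natl -sumr_const [leRHS](bigD1 e) //= lerDr.
  exact: exprn_ge0.
under eq_bigr => G _.
  rewrite sqrrB mulrDr mulrBr; over.
rewrite big_split sumrB /= -mulr_suml Gnp_total mul1r.
have -> : \sum_G weight G *
    (#|(S :&: edges G)%SET|%:R * (#|S|%:R * p) *+ 2)
  = (#|S|%:R * p) ^+ 2 *+ 2.
  rewrite [in RHS]expr2 -[in X in _ = X * _ *+ _]EZ -[RHS]mulr_natr !mulr_suml.
  by apply: eq_bigr => G _; rewrite -mulr_natr; ring.
by move: EZ2; lra.
Qed.

Variables (V : finType) (F : r_graph r V).

(** From each copy of [F] in the intersection, the image of one fixed edge [f0] is deleted. A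
    surviving copy would itself have lost its image of [f0]. *)
Lemma turan_ex_deletion (G H : r_graph r 'I_n) : (0 < nb_edges F)%N ->
  (#|(edges H :&: edges G)%SET| <= turan_ex G F +
   #|[set phi in copies F H | [set (phi @: (f : {set V}))%SET | f in edges F]
                              \subset edges G]%SET|)%N.
Proof.
case/card_gt0P => f0 f0F; set Y := [set phi in _ | _]%SET.
pose D := [set (phi @: f0)%SET | phi : {ffun V -> 'I_n} in Y]%SET.
pose G' := uniform_part r (edges H :&: edges G :\: D)%SET.
have G'E : edges G' = (edges H :&: edges G :\: D)%SET.
  apply/setP => e; rewrite mem_uniform_part; apply: andb_idr.
  by rewrite !inE => /andP[_ /andP[/card_edge -> _]].
apply: (@leq_trans (nb_edges G' + #|D|)).
  by rewrite /nb_edges G'E addnC -leq_subLR cardsD leq_sub2l // subset_leq_card // finset.subsetIr.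
apply: leq_add; last exact: leq_imset_card.
rewrite /turan_ex; apply: leq_bigmax_cond; apply/andP; split.
  by rewrite G'E; apply/fintype.subsetP => e; rewrite !inE => /and3P[].
apply/forallP => phi; apply/implyP => phiG'; apply/negP => phi_inj.
have phiG f : f \in edges F -> (phi @: f)%SET \in (edges H :&: edges G :\: D)%SET.
  by move=> fF; rewrite -G'E (forall_inP phiG').
have := phiG f0 f0F; rewrite finset.in_setD => /andP[/negP + _]; apply.
apply: imset_f; rewrite !inE phi_inj andbT; apply/andP; split.
  by apply/forall_inP => f /phiG; rewrite !inE => /and3P[].
apply/fintype.subsetP => e /imsetP[f /phiG + ->].
by rewrite !inE => /and3P[].
Qed.

Lemma Gnp_turan_lower_bound (H : r_graph r 'I_n) : (0 < nb_edges F)%N ->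
  0 < (nb_edges H)%:R * p ->
  1 - 4 / ((nb_edges H)%:R * p)
    - 4 * #|copies F H|%:R * p ^+ nb_edges F / ((nb_edges H)%:R * p)
  <= Gnp_prob p [set G : r_graph r 'I_n |
       (nb_edges H)%:R * p / 4 <= (turan_ex G F)%:R]%SET.
Proof.
move=> F0; set mu := _ * p => mu0.
pose Z (G : r_graph r 'I_n) : R := #|(edges H :&: edges G)%SET|%:R.
pose image (phi : {ffun V -> 'I_n}) :=
  [set (phi @: (f : {set V}))%SET | f in edges F]%SET.
pose Y (G : r_graph r 'I_n) : R :=
  #|[set phi in copies F H | image phi \subset edges G]%SET|%:R.
have rH e : e \in edges H -> #|e| = r by apply: card_edge.
have EY : \sum_G weight G * Y G = #|copies F H|%:R * p ^+ nb_edges F.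
  have YE G : Y G = \sum_(phi in copies F H) (image phi \subset edges G)%:R.
    rewrite /Y -sum1_card natr_sum big_mkcond [RHS]big_mkcond /=.
    apply: eq_bigr => phi _; rewrite finset.in_set.
    by case: (phi \in _); case: (image phi \subset _).
  under eq_bigr => G _ do rewrite YE mulr_sumr.
  rewrite exchange_big /= mulr_natl -sumr_const; apply: eq_bigr => phi.
  rewrite inE => /andP[phiH /injectiveP phi_inj].
  rewrite Gnp_expect_supset ?imset_copy_inj // => e /imsetP[f fF ->].
  exact/rH/(forall_inP phiH).
(* Outside [B1] more than [mu / 2] edges remain (Chebyshev, variance at most [mu]); outside [B2]
   fewer than [mu / 4] copies must be destroyed (Markov). *)
pose B1 := [set G | mu ^+ 2 / 4 <= (Z G - mu) ^+ 2]%SET.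
pose B2 := [set G | mu / 4 <= Y G]%SET.
have P1 : Gnp_prob p B1 <= 4 / mu.
  have m2 : 0 < mu ^+ 2 / 4 by rewrite divr_gt0 ?exprn_gt0.
  rewrite -(ler_pM2r m2).
  apply: le_trans (Gnp_markov _ (fun G => sqr_ge0 _)) _.
  apply: le_trans (Gnp_edges_variance rH) _.
  rewrite -/(nb_edges H) -/mu le_eqVlt; apply/orP; left; apply/eqP.
  by field; rewrite gt_eqF.
have P2 : Gnp_prob p B2 <= 4 * #|copies F H|%:R * p ^+ nb_edges F / mu.
  have m4 : 0 < mu / 4 by rewrite divr_gt0.
  rewrite -(ler_pM2r m4).
  apply: le_trans (Gnp_markov _ (fun G => ler0n _ _)) _.
  rewrite EY -[4 * _ * _]mulrA; set q := _ * p ^+ _.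
  rewrite le_eqVlt; apply/orP; left; apply/eqP.
  by move: q => q; field; rewrite gt_eqF.
apply: le_trans (Gnp_union_bound (B1 := B1) (B2 := B2) _) => [|G].
  by rewrite -!addrA lerD2l -!opprD lerN2 lerD.
rewrite !inE -!ltNge => Z1 Y1; apply: deviation_arith mu0 Z1 Y1 _.
by rewrite -natrD ler_nat; apply: turan_ex_deletion.
Qed.

End RandomGraph.

(** * Quantitative bound from one random set system *)

Lemma expn_le_ffact (n r : nat) : (2 * r <= n)%N ->
  (n ^ r <= 2 ^ r * n ^_ r)%N.
Proof.
move=> rn; rewrite ffact_prod -[X in (n ^ X)%N]card_ord -[X in (2 ^ X)%N]card_ord.
rewrite -!prod_nat_const -big_split /=; apply: leq_prod => i _.
by have := ltn_ord i; lia.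
Qed.

(** The least [N] with [a ^+ N <= y] works: by minimality the previous power exceeds [y].
    Integrality of [N] thus costs only a factor [a]. *)
Lemma expr_between (R : realType) (a y : R) : 0 < a < 1 -> 0 < y <= 1 ->
  exists N, a * y <= a ^+ N <= y.
Proof.
move=> /andP[a0 a1] /andP[y0 y1].
have exN : exists N, a ^+ N <= y.
  have := @cvg_expr R a; rewrite gtr0_norm // => /(_ a1)/cvgrPdist_le/(_ _ y0).
  case=> N _ /(_ N (leqnn N)) /=; rewrite sub0r normrN ger0_norm; first by exists N.
  by rewrite exprn_ge0 // ltW.
case: (ex_minnP exN) => -[|N] aN minN.
  by exists 0%N; rewrite aN expr0 andbT mulr_ile1 //; apply: ltW.
exists N.+1; rewrite aN andbT exprS ler_pM2l // leNgt; apply/negP => /ltW/minN.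
by rewrite ltnn.
Qed.

Section Asymptotics.
Variables (R : realType) (r : nat) (V : finType) (F : r_graph r V).
Hypotheses (r2 : (2 <= r)%N) (e2 : (2 <= nb_edges F)%N).

Local Notation e := (nb_edges F).
Local Notation m := (threshold_exponent R F).

(** On at most [r] vertices the only possible edge is the whole vertex set. *)
Lemma vertices_gt_uniformity : (r < #|V|)%N.
Proof.
rewrite ltnNge; apply/negP => vr; move: e2; apply/negP; rewrite -ltnNge ltnS.
rewrite -(cards1 [set: V]%SET); apply: subset_leq_card.
apply/fintype.subsetP => f /card_edge fr; rewrite inE eqEcard finset.subsetT.
by rewrite cardsT fr.
Qed.

Lemma threshold_exponent_gt0 : 0 < m.
Proof.
by rewrite divr_gt0 // subr_gt0 ?ltr1n // ltr_nat; apply: vertices_gt_uniformity.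
Qed.

(** The probabilities [a] and [b] must not depend on [n]. *)
Definition attainable (a b : R) := forall n : nat,
  exists (T : finType) (A : T -> {set {set 'I_n}}), random_system F A a b.

Lemma turan_bound_of_attainable (a b p : R) (n N : nat) :
  attainable a b -> 0 < a -> 0 < b -> (r <= n)%N -> 0 < p <= 1 ->
  let x := 'C(n, r)%:R * a ^+ N * p in
  1 - 8 / x - 8 * ((n ^ #|V|)%:R * b ^+ N * p ^+ e / x)
  <= Gnp_prob p [set G : r_graph r 'I_n | x / 8 <= (turan_ex G F)%:R]%SET.
Proof.
move=> att a0 b0 rn /andP[p0 p1]; cbv zeta; set x := 'C(n, r)%:R * a ^+ N * p.
have n0 : (0 < n)%N by apply: leq_trans rn; apply: ltnW.
set a' := 'C(n, r)%:R * a ^+ N in x *; set b' := (n ^ #|V|)%:R * b ^+ N.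
have a'0 : 0 < a' by rewrite mulr_gt0 ?exprn_gt0 // ltr0n bin_gt0.
have b'0 : 0 < b' by rewrite mulr_gt0 ?exprn_gt0 // ltr0n expn_gt0 n0.
have [T [A /(random_system_exp N) Aab]] := att n.
(* With this [lam] the mean of the difference is [a' / 2], which forces both X >= a'/2 and Y <= X /
   lam. *)
pose lam := a' / (2 * b').
have lam0 : 0 < lam by rewrite divr_gt0 // mulr_gt0.
have [H] := random_system_ex Aab (exprn_ge0 N (ltW b0)) (ltW lam0).
rewrite card_ord -/a' -[lam * _ * _]mulrA -/b'.
have -> : a' - lam * b' = a' / 2 by rewrite /lam; field; rewrite gt_eqF.
set X : R := (nb_edges H)%:R; set Y : R := #|copies F H|%:R => XY.
have Y0 : 0 <= Y by apply: ler0n.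
have lamY : 0 <= lam * Y by rewrite mulr_ge0 // ltW.
have aX : a' / 2 <= X by lra.
have X0 : 0 < X by apply: lt_le_trans aX; rewrite divr_gt0.
have Xp0 : 0 < X * p by rewrite mulr_gt0.
have YX : Y <= 2 * b' / a' * X.
  have -> : 2 * b' / a' = lam^-1 by rewrite /lam invf_div.
  by rewrite ler_pdivlMl //; lra.
have x0 : 0 < x by rewrite mulr_gt0.
have xX : x / 8 <= X * p / 4.
  have aXp : a' / 2 * p <= X * p by rewrite ler_pM2r.
  by rewrite /x; lra.
have p01 : 0 <= p <= 1 by rewrite ltW.
have e0 : (0 < e)%N by apply: ltnW.
apply: le_trans (le_trans (Gnp_turan_lower_bound p01 e0 Xp0) _).
  rewrite -/X -/Y; apply: lerB; first (apply: lerB => //).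
    rewrite ler_pdivrMr // mulrAC ler_pdivlMr //.
    by move: xX; lra.
  set q := p ^+ e; have q0 : 0 < q by rewrite exprn_gt0.
  have : Y * q / (X * p) <= 2 * b' / a' * X * q / (X * p).
    by rewrite ler_pM2r ?invr_gt0 // ler_pM2r.
  have -> : 2 * b' / a' * X * q / (X * p) = 2 * (b' * q / x).
    move: (q) => q1; rewrite /x; field; rewrite !gt_eqF //.
  rewrite -!(mulrA 4).
  by move: (Y * q / (X * p)) (b' * q / x) => u w uw; lra.
apply: Gnp_prob_mono => //; apply/fintype.subsetP => G; rewrite !inE.
by rewrite -/X; apply: le_trans.
Qed.

Lemma powR_mul_add (x u w : R) : 0 < x -> x `^ u * x `^ w = x `^ (u + w).
Proof. by move=> x0; rewrite powRD // (gt_eqF x0) /= implybT. Qed.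

Lemma powR_le1 (x u : R) : 1 <= x -> u <= 0 -> x `^ u <= 1.
Proof. by move=> x1 u0; rewrite -(powRr0 x) ler_powR. Qed.

Lemma powR_ge1 (x u : R) : 1 <= x -> 0 <= u -> 1 <= x `^ u.
Proof. by move=> x1 u0; rewrite -(powRr0 x) ler_powR. Qed.

Lemma near_powR_ge (t C : R) : 0 < t ->
  \forall n \near \oo%classic, C <= n%:R `^ t.
Proof.
move=> t0; near=> n; apply: (le_trans (ler_norm C)).
have -> : `|C| = (`|C| `^ t^-1) `^ t.
  by rewrite -powRrM mulVf ?gt_eqF // powRr1.
apply: (ge0_ler_powR (ltW t0)); rewrite ?nnegrE ?powR_ge0 ?ler0n //.
near: n; exact: nbhs_infty_ger.
Unshelve. all: by end_near. Qed.

Lemma binomial_ge (n : nat) : (2 * r <= n)%N ->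
  (2 ^ r * r`!)%:R^-1 * n%:R `^ r%:R <= 'C(n, r)%:R :> R.
Proof.
move=> rn; rewrite powR_mulrn // ler_pdivrMl ?ltr0n ?muln_gt0 ?expn_gt0 ?fact_gt0 //.
rewrite -natrX -natrM ler_nat mulnAC -mulnA bin_ffact.
exact: expn_le_ffact.
Qed.

Lemma turan_bound_powR (a s g : R) :
  0 < a < 1 -> 0 <= s -> attainable a (a `^ (s + e%:R)) -> 0 < g ->
  exists2 C, 0 < C & forall (n : nat) (p : R), (2 * r <= n)%N ->
    n%:R `^ (- m) <= p <= 1 ->
    1 - C * n%:R `^ (- (r%:R - m - g)) - C * n%:R `^ (- (g * (e%:R - 1 + s)))
    <= Gnp_prob p [set G : r_graph r 'I_n |
      n%:R `^ (r%:R - m - g) * (p * n%:R `^ m) `^ (s / (e%:R - 1 + s)) / C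
      <= (turan_ex G F)%:R]%SET.
Proof.
move=> /andP[a0 a1] s0 att g0; pose c : R := (2 ^ r * r`!)%:R^-1.
have c0 : 0 < c by rewrite invr_gt0 ltr0n muln_gt0 expn_gt0 fact_gt0.
exists (8 / (c * a)); first by rewrite divr_gt0 // mulr_gt0.
move=> n p rn /andP[pm p1]; set kappa := e%:R - 1 + s.
have e1 : 1 <= e%:R - 1 :> R by rewrite lerBrDr -mulr2n ler_nat.
have k0 : 0 < kappa by rewrite /kappa; lra.
have n1 : (1 <= n)%N by apply: leq_trans rn; rewrite muln_gt0 /=; apply: ltnW.
set L : R := n%:R; have L1 : 1 <= L by rewrite ler1n.
have L0 : 0 < L by apply: lt_le_trans L1.
have p0 : 0 < p by apply: lt_le_trans pm; apply: powR_gt0.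
pose X := p * L `^ m.
have X1 : 1 <= X.
  by rewrite -ler_pdivrMr ?powR_gt0 // div1r -powRN.
have X0 : 0 < X by apply: lt_le_trans X1.
have pE : p = X * L `^ (- m) by rewrite /X -mulrA powR_mul_add // subrr powRr0 mulr1.
(* The first factor is the density at which copies and edges balance; the second makes copies rarer
   by a power of [L]. *)
pose y := X `^ (- ((e%:R - 1) / kappa)) * L `^ (- g).
have y01 : 0 < y <= 1.
  rewrite mulr_gt0 ?powR_gt0 //= mulr_ile1 ?powR_ge0 //.
    by apply: powR_le1; rewrite // oppr_le0 divr_ge0 // ltW //; lra.
  by apply: powR_le1; rewrite // oppr_le0 ltW.
have [|N /andP[ayN aNy]] := @expr_between R a y _ y01; first by rewrite a0.
have rlen : (r <= n)%N by apply: leq_trans rn; rewrite leq_pmull.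
have cbin := binomial_ge rn; rewrite -/c -/L in cbin.
have := turan_bound_of_attainable N att a0 (powR_gt0 _ a0) rlen
  (introT andP (conj p0 p1)).
cbv zeta; set x := 'C(n, r)%:R * a ^+ N * p.
set q := L `^ (r%:R - m - g) * X `^ (s / kappa).
have q0 : 0 < q by rewrite mulr_gt0 ?powR_gt0.
have ca0 : 0 < c * a by rewrite mulr_gt0.
have qx : c * a * q <= x.
  (* The factor [X] coming from [p] raises the exponent -(e - 1)/kappa of [X] in [y] to s/kappa. *)
  have -> : c * a * q = (c * L `^ r%:R) * (a * y) * p.
    rewrite /q [in RHS]pE /y.
    have -> : s / kappa = - ((e%:R - 1) / kappa) + 1.
      by rewrite /kappa; field; rewrite gt_eqF.
    rewrite -!powR_mul_add // powRr1 ?ltW //; ring.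
  rewrite /x ler_pM2r //; have /andP[/ltW y0 _] := y01.
  by apply: ler_pM; rewrite // mulr_ge0 ?powR_ge0 // ltW.
have x0 : 0 < x by apply: lt_le_trans qx; rewrite mulr_gt0.
have qL : L `^ (r%:R - m - g) <= q.
  rewrite ler_peMr ?powR_ge0 //; apply: powR_ge1 => //.
  by rewrite divr_ge0 // ltW.
(* With A = a^N and L^(v(F) - r) = L^(m (e - 1)), the ratio of copies to edges is at most X^(e - 1)
   A^kappa up to the constant 1/c, and A <= y. *)
have copies_small : (n ^ #|V|)%:R * (a `^ (s + e%:R)) ^+ N * p ^+ e / x
    <= c^-1 * L `^ (- (g * kappa)).
  set A := a ^+ N in x x0 qx ayN aNy *.
  have A0 : 0 < A by rewrite exprn_gt0.
  have -> : (a `^ (s + e%:R)) ^+ N = A * A `^ kappa.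
    rewrite -powR_mulrn ?powR_ge0 // -powRrM mulrC powRrM powR_mulrn ?ltW // -/A.
    rewrite -{2}(powRr1 (ltW A0)) powR_mul_add //; congr (_ `^ _).
    by rewrite /kappa; ring.
  have -> : p ^+ e = p * p `^ (e%:R - 1).
    rewrite -powR_mulrn ?ltW // -{2}(powRr1 (ltW p0)) powR_mul_add //.
    by congr (_ `^ _); ring.
  have -> : (n ^ #|V|)%:R = L `^ #|V|%:R :> R by rewrite powR_mulrn ?ltW // natrX.
  have C0 : 0 < 'C(n, r)%:R :> R by rewrite ltr0n bin_gt0.
  rewrite ler_pdivrMr // /x.
  apply: (@le_trans _ _ (L `^ r%:R * L `^ (- (g * kappa)) * (A * p))); last first.
    have Lr : L `^ r%:R <= c^-1 * 'C(n, r)%:R by rewrite ler_pdivlMl.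
    rewrite [leRHS](_ : _ = c^-1 * 'C(n, r)%:R * L `^ (- (g * kappa)) * (A * p));
      last by ring.
    by rewrite ler_pM2r ?mulr_gt0 // ler_pM2r ?powR_gt0.
  have -> : L `^ #|V|%:R = L `^ r%:R * L `^ (m * (e%:R - 1)).
    rewrite powR_mul_add //; congr (_ `^ _).
    rewrite /threshold_exponent /nb_vertices divfK ?gt_eqF //; first by ring.
    by apply: lt_le_trans e1.
  have Ak : A `^ kappa <= X `^ (- (e%:R - 1)) * L `^ (- (g * kappa)).
    apply: (@le_trans _ _ (y `^ kappa)).
      by apply: (ge0_ler_powR (ltW k0)); rewrite // nnegrE ltW //; case/andP: y01.
    rewrite /y powRM ?powR_ge0 // -!powRrM !mulNr divfK ?gt_eqF //.
  have XE : X `^ (e%:R - 1) = p `^ (e%:R - 1) * L `^ (m * (e%:R - 1)).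
    by rewrite /X powRM ?powR_ge0 ?ltW // powRrM.
  rewrite [leLHS](_ : _ = L `^ r%:R * (A * p) * (X `^ (e%:R - 1) * A `^ kappa));
    last by rewrite XE; ring.
  rewrite [leRHS](_ : _ = L `^ r%:R * (A * p) * L `^ (- (g * kappa)));
    last by ring.
  rewrite ler_pM2l ?mulr_gt0 ?powR_gt0 //.
  have X1E : X `^ (e%:R - 1) * X `^ (- (e%:R - 1)) = 1.
    by rewrite powR_mul_add // subrr powRr0.
  rewrite [leRHS](_ : _ = X `^ (e%:R - 1)
    * (X `^ (- (e%:R - 1)) * L `^ (- (g * kappa)))); last by rewrite mulrA X1E mul1r.
  by rewrite ler_pM2l ?powR_gt0.
move=> bound; apply: le_trans (le_trans bound _).
  apply: lerB; first (apply: lerB => //).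
    have caL : 0 < c * a * L `^ (r%:R - m - g) by rewrite mulr_gt0 ?powR_gt0.
    rewrite powRN -mulrA -invfM ler_pM2l // lef_pV2 ?posrE //.
    by apply: le_trans qx; rewrite ler_pM2l.
  rewrite -[leRHS]mulrA ler_pM2l //; apply: le_trans copies_small _.
  rewrite ler_pM2r ?powR_gt0 // lef_pV2 ?posrE //.
  by rewrite ler_piMr ?ltW.
apply: Gnp_prob_mono; first by rewrite ltW.
apply/fintype.subsetP => G; rewrite !inE; apply: le_trans.
by rewrite invf_div mulrA ler_pM2r ?invr_gt0 // mulrC.
Qed.

End Asymptotics.

(** * Approximating the gap exponent by attainable pairs *)

Section GapExponent.
Variables (R : realType) (r : nat) (V : finType) (F : r_graph r V).
Hypotheses (r2 : (2 <= r)%N) (e2 : (2 <= nb_edges F)%N).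

Local Notation e := (nb_edges F).

(** For empty [W] the denominator is a positive power of 0, and division by 0 makes the density
    0. *)
Lemma hom_density_target_gt0 (W : finType) (H : r_graph r W) :
  0 < hom_density R F H -> (0 < #|W|)%N.
Proof.
rewrite lt0n; apply: contraPneq => W0; rewrite /hom_density /nb_vertices W0.
have V0 : (0 < #|V|)%N by apply: leq_ltn_trans (vertices_gt_uniformity e2).
by rewrite expr0n -[_ == 0%N]negbK -lt0n V0 invr0 mulr0 ltxx.
Qed.

(** In a random pullback of [H] to [V], presence of the identity copy of [F] forces presence of its
    edge [f]. *)
Lemma hom_density_le_edge (W : finType) (H : r_graph r W) : (0 < #|W|)%N ->
  hom_density R F H <= hom_density R (single_edge r) H.
Proof.
move=> W0; have [T0 Ha Hb] := random_system_hom R V F H W0.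
have /card_gt0P[f fF] : (0 < e)%N by apply: ltnW.
pose phi := [ffun v : V => v].
have phi_inj : injective phi by move=> u v; rewrite !ffunE.
have T0R : 0 < #|{ffun V -> W}|%:R :> R by rewrite ltr0n.
rewrite -(ler_pM2r T0R) -(Hb phi) // -(Ha f) ?(card_edge fF) // ler_nat.
apply: subset_leq_card; apply/fintype.subsetP => chi; rewrite inE.
move=> /forall_inP/(_ f fF); rewrite [in X in _ -> X]inE.
suff -> : (phi @: f)%SET = f by [].
apply/setP => v; apply/imsetP/idP => [[u uf ->]|vf]; first by rewrite ffunE.
by exists v; rewrite ?ffunE.
Qed.

(** Constant maps are not homomorphisms, since [r >= 2]. *)
Lemma edge_density_lt1 (W : finType) (H : r_graph r W) : (0 < #|W|)%N ->
  hom_density R (single_edge r) H < 1.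
Proof.
move=> W0; rewrite /hom_density /nb_vertices card_ord.
have W0R : 0 < #|W|%:R ^+ r :> R by rewrite exprn_gt0 // ltr0n.
rewrite ltr_pdivrMr // mul1r -natrX ltr_nat -[X in (_ ^ X)%N]card_ord -card_ffun.
rewrite -cardsT; apply: proper_card; rewrite properE finset.subsetT /=.
have [w _] := card_gt0P W0.
apply/negP => /fintype.subsetP/(_ [ffun=> w]); rewrite !inE => /(_ isT).
rewrite single_edge_hom => /card_edge; apply/eqP; rewrite neq_ltn.
suff -> : ([ffun=> w] @: [set: 'I_r] = [set w])%SET by rewrite cards1 r2.
apply/setP => x; rewrite inE; apply/imsetP/eqP => [[i _ ->]|->].
  by rewrite ffunE.
by exists (Ordinal (ltnW r2)); rewrite ?ffunE.
Qed.

(** The bound [1 <= s + e] expresses t_F(H) <= t_K(H) for a base below 1; it controls the sign of e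
    - 1 + s(F) when s(F) <= 0. *)
Lemma attainable_hom (s : R) (W : finType) (H : r_graph r W) :
  hom_density R F H = hom_density R (single_edge r) H `^ (s + e%:R) ->
  0 < hom_density R F H ->
  exists a, [/\ 0 < a < 1, 1 <= s + e%:R & attainable F a (a `^ (s + e%:R))].
Proof.
move=> FE F0; have W0 := hom_density_target_gt0 F0.
set a := hom_density R (single_edge r) H in FE.
have a0 : 0 < a by apply: lt_le_trans (hom_density_le_edge H W0).
have a1 : a < 1 by apply: edge_density_lt1.
exists a; split; first by rewrite a0.
  have := hom_density_le_edge H W0; rewrite FE -/a -ler_ln ?posrE ?powR_gt0 //.
  rewrite ln_powR -[leRHS]mul1r ler_nM2r //.
  by rewrite ln_lt0 // a0.
move=> n; exists {ffun 'I_n -> W}; eexists; rewrite -FE.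
exact: random_system_hom.
Qed.

Lemma attainable_half :
  attainable F (2^-1 : R) (2^-1 `^ (0 + e%:R)).
Proof.
move=> n; exists {set {set 'I_n}}; eexists.
rewrite add0r powR_mulrn ?invr_ge0 //; exact: random_system_half.
Qed.

Lemma gap_exponent_approx (eps : R) : 0 < eps ->
  exists a s, [/\ 0 < a < 1, 0 <= s, attainable F a (a `^ (s + e%:R))
    & gap_exponent R F - eps <= s / (e%:R - 1 + s)].
Proof.
move=> eps0.
have e1 : 1 <= e%:R - 1 :> R by rewrite lerBrDr -mulr2n ler_nat.
(* Nonpositive targets are met by [s = 0]. *)
have half (t : R) : t <= 0 -> exists a s,
    [/\ 0 < a < 1, 0 <= s, attainable F a (a `^ (s + e%:R))
      & t - eps <= s / (e%:R - 1 + s)].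
  move=> t0; exists 2^-1, 0; split=> //.
  - by rewrite invr_gt0 ltr0n invf_lt1 // ltr1n.
  - exact: attainable_half.
  by rewrite mul0r; lra.
rewrite /gap_exponent; case gapE : (sidorenko_gap R F) => [g| |].
- have [g0|g0] := leP g 0.
    (* [g >= 1 - e(F)], so [g / (e(F) - 1 + g)] is nonpositive, also where the
       denominator vanishes and the quotient is [0]. *)
    apply: half; have : (-oo < sidorenko_gap R F)%E by rewrite gapE ltNyr.
    case/ereal_sup_gt => _ [s [W [H [FE F0]]] <-] _.
    have sg : s <= g.
      rewrite -lee_fin -gapE; apply: ereal_sup_ubound.
      by exists s => //; exists W, H.
    have [_ [_ se _]] := attainable_hom FE F0.
    by rewrite mulr_le0_ge0 // invr_ge0; lra.
  pose t := Num.max 0 (g - eps).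
  have : (t%:E < sidorenko_gap R F)%E.
    by rewrite gapE lte_fin gt_max g0 gtrBl eps0.
  case/ereal_sup_gt => _ [s [W [H [FE F0]]] <-].
  rewrite lte_fin gt_max => /andP[s0 gs].
  have sg : s <= g.
    rewrite -lee_fin -gapE; apply: ereal_sup_ubound.
    by exists s => //; exists W, H.
  have [a [a01 _ att]] := attainable_hom FE F0.
  exists a, s; split=> //; first by rewrite ltW.
  rewrite lerBlDr -lerBlDl.
  move: (e%:R - 1) e1 => k k1.
  (* As k >= 1, the denominator is at least k, so the difference is at most g - s < eps. *)
  have -> : g / (k + g) - s / (k + s) = (k * (g - s)) / ((k + g) * (k + s)).
    by field; rewrite !gt_eqF //; lra.
  rewrite ler_pdivrMr; last by rewrite mulr_gt0 //; lra.
  have : k * (g - s) <= k * eps by rewrite ler_pM2l; lra.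
  have : k <= (k + g) * (k + s) by nra.
  move=> h1 h2; apply: le_trans h2 _; rewrite mulrC ler_pM2l //.
(* Beyond this [t], the gap 1 - s/(k + s) = k/(k + s), with k = e - 1, is below [eps]. *)
- pose t := (e%:R - 1) / eps.
  have t0 : 0 < t by rewrite divr_gt0 //; lra.
  have : (t%:E < sidorenko_gap R F)%E by rewrite gapE ltry.
  case/ereal_sup_gt => _ [s [W [H [FE F0]]] <-]; rewrite lte_fin => ts.
  have [a [a01 _ att]] := attainable_hom FE F0.
  exists a, s; split=> //; first by rewrite ltW // (lt_trans t0).
  move: (e%:R - 1) e1 @t t0 ts => k k1 t t0 ts.
  have s0 : 0 < s by apply: lt_trans ts.
  rewrite ler_pdivlMr; last by lra.
  by move: ts; rewrite /t ltr_pdivrMr //; nra.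
by apply: half.
Qed.

End GapExponent.

(** * Diagonal sequence and conclusion *)

Lemma diagonal_cvg1 (R : realType) (P : nat -> R -> R) :
  (forall n d, 0 <= P n d <= 1) ->
  (forall d t, 0 < d -> 0 < t -> \forall n \near \oo%classic, 1 - t <= P n d) ->
  exists eps : nat -> R, (eps n @[n --> \oo] --> (0 : R))%classic /\
    (P n (eps n) @[n --> \oo] --> (1 : R))%classic.
Proof.
move=> P01 Plim.
(* [eps n] is the least [1 / (k + 1)] with [k <= n] for which the estimate
   [P n (1 / (k + 1)) >= 1 - 1 / (k + 1)] already holds. *)
pose good n k := (k <= n)%N && (1 - harmonic k <= P n (harmonic k)).
have good0 n : exists k, good n k.
  (* At k = 0 the required probability is 1 - 1 = 0. *)
  by exists 0%N; rewrite /good /= invr1 subrr; case/andP: (P01 n 1).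
have good_le n k : good n k -> (k <= n)%N by case/andP.
pose k n := ex_maxn (good0 n) (good_le n).
have kP n : good n (k n) by rewrite /k; case: ex_maxnP.
have k_max n j : good n j -> (j <= k n)%N by rewrite /k; case: ex_maxnP => i _; apply.
pose eps n : R := harmonic (k n).
have eps0 : (eps n @[n --> \oo] --> (0 : R))%classic.
  apply/cvgrPdist_le => t t0.
  have [K Kt] : exists K, @harmonic R K <= t.
    have /cvgrPdist_le/(_ _ t0)[K _ /(_ K (leqnn K))] := @cvg_harmonic R.
    by rewrite /= sub0r normrN ger0_norm ?harmonic_ge0 //; exists K.
  near=> n; rewrite sub0r normrN ger0_norm ?harmonic_ge0 //.
  apply: le_trans Kt; rewrite lef_pV2 ?posrE ?ltr0n // ler_nat ltnS.
  apply: k_max; apply/andP; split; first by near: n; exact: nbhs_infty_ge.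
  by near: n; apply: Plim; apply: harmonic_gt0.
exists eps; split=> //.
apply: (@squeeze_cvgr _ _ _ _ (fun n => 1 - eps n) (fun=> 1)).
- apply: nearW => n; have /andP[_ ->] := kP n.
  by case/andP: (P01 n (eps n)).
- by rewrite -[X in (_ --> X)%classic]subr0; apply: cvgB => //; apply: cvg_cst.
exact: cvg_cst.
Unshelve. all: by end_near. Qed.

Lemma Gnp_prob_ge0 (R : realType) (r n : nat) (p : R)
    (A : {set r_graph r 'I_n}) : 0 <= p <= 1 -> 0 <= Gnp_prob p A.
Proof.
move=> /andP[p0 p1]; apply: sumr_ge0 => G _; apply: prodr_ge0 => e _.
by case: ifP; rewrite ?subr_ge0.
Qed.

(* [X <= L ^ m] trades the exponent error [th - th'] for a power of [L]. *)
Lemma powR_absorb (R : realType) (L X D d g m th th' C : R) :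
  1 <= L -> 1 <= X <= L `^ m -> 0 < m -> 0 < d -> g <= d / 4 ->
  C <= L `^ (d / 4) -> th - d / (2 * m) <= th' ->
  L `^ (D - d) * X `^ th * C <= L `^ (D - g) * X `^ th'.
Proof.
move=> L1 /andP[X1 XL] m0 d0 gd CL ths.
have L0 : 0 < L by apply: lt_le_trans L1.
have X0 : 0 < X by apply: lt_le_trans X1.
have Xth : X `^ th <= X `^ th' * L `^ (d / 2).
  have -> : th = th' + (th - th') by ring.
  rewrite -powR_mul_add // ler_pM2l ?powR_gt0 //.
  apply: (@le_trans _ _ (X `^ (d / (2 * m)))); first by apply: ler_powR => //; lra.
  have -> : d / 2 = m * (d / (2 * m)) by field; rewrite gt_eqF.
  rewrite (powRrM L); apply: ge0_ler_powR; rewrite ?nnegrE ?powR_ge0 ?(ltW X0) //.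
  by rewrite divr_ge0 // ltW // mulr_gt0.
apply: (@le_trans _ _ (L `^ (D - d) * (X `^ th' * L `^ (d / 2)) * L `^ (d / 4))).
  apply: le_trans (_ : L `^ (D - d) * X `^ th * L `^ (d / 4) <= _).
    by rewrite ler_pM2l // mulr_gt0 ?powR_gt0.
  by rewrite ler_pM2r ?powR_gt0 // ler_pM2l ?powR_gt0.
rewrite [leLHS](_ : _ = L `^ (D - d) * L `^ (d / 2) * L `^ (d / 4) * X `^ th');
  last by ring.
(* The loss [d] is spent as d/2 on the exponent of [X], d/4 on [C] and d/4 on [g]. *)
rewrite !powR_mul_add // ler_pM2r ?powR_gt0 //; apply: ler_powR => //; lra.
Qed.

Lemma turan_bound_eventually (R : realType) (r : nat) (V : finType)
    (F : r_graph r V) (p : nat -> R) :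
  (2 <= r)%N -> (2 <= nb_edges F)%N -> threshold_exponent R F < r%:R ->
  (forall n, 0 <= p n <= 1) ->
  (forall n, (0 < n)%N -> n%:R `^ (- threshold_exponent R F) <= p n) ->
  forall d t : R, 0 < d -> 0 < t -> \forall n \near \oo%classic,
    1 - t <= Gnp_prob (p n)
      [set G : r_graph r 'I_n |
        n%:R `^ (r%:R - threshold_exponent R F - d)
          * (p n * n%:R `^ threshold_exponent R F) `^ gap_exponent R F
        <= (turan_ex G F)%:R]%SET.
Proof.
move=> r2 e2; have m0 := threshold_exponent_gt0 R e2.
move: m0; set m := threshold_exponent R F; set th := gap_exponent R F.
move=> m0 mr p01 pm d t d0 t0.
have eps0 : 0 < d / (2 * m) by rewrite divr_gt0 // mulr_gt0.
have [a [s [a01 s0 att ths]]] := gap_exponent_approx r2 e2 eps0.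
rewrite -/th in ths.
(* The second bound keeps r - m - g positive, so that the edge error term tends to 0. *)
pose g := Num.min (d / 4) ((r%:R - m) / 2).
have g0 : 0 < g by rewrite lt_min !divr_gt0 //; lra.
have gd : g <= d / 4 by rewrite ge_min lexx.
have gr : g <= (r%:R - m) / 2 by rewrite ge_min lexx orbT.
have [C C0 bound] := turan_bound_powR r2 e2 a01 s0 att g0.
have small u : 0 < u -> \forall n \near \oo%classic, C * n%:R `^ (- u) <= t / 2.
  move=> u0; near=> n.
  have n0 : 0 < n%:R :> R by rewrite ltr0n; near: n; exact: nbhs_infty_gt.
  rewrite powRN ler_pdivrMr ?powR_gt0 // -ler_pdivrMl ?divr_gt0 //.
  by near: n; apply: near_powR_ge.
have e1 : 1 <= (nb_edges F)%:R - 1 :> R by rewrite lerBrDr -mulr2n ler_nat.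
near=> n.
have n0 : (0 < n)%N by near: n; exact: nbhs_infty_gt.
have rn : (2 * r <= n)%N by near: n; exact: nbhs_infty_ge.
have pn : n%:R `^ (- m) <= p n <= 1 by rewrite pm //=; case/andP: (p01 n).
have t1 : C * n%:R `^ (- (r%:R - m - g)) <= t / 2.
  by near: n; apply: small; lra.
have t2 : C * n%:R `^ (- (g * ((nb_edges F)%:R - 1 + s))) <= t / 2.
  by near: n; apply: small; rewrite mulr_gt0 //; lra.
have CL : C <= n%:R `^ (d / 4) by near: n; apply: near_powR_ge; rewrite divr_gt0.
apply: le_trans (le_trans (bound n (p n) rn pn) _).
  by rewrite -/m; move: t1 t2; lra.
apply: Gnp_prob_mono; first exact: p01.
apply/fintype.subsetP => G; rewrite !inE; apply: le_trans.
have L1 : 1 <= n%:R :> R by rewrite ler1n.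
have [pm' p1] := andP pn.
rewrite -/m ler_pdivlMr //; apply: powR_absorb (ths); rewrite //.
(* The lower bound on [p n] gives 1 <= X, and [p n <= 1] gives X <= L^m. *)
apply/andP; split.
  by rewrite -ler_pdivrMr ?powR_gt0 ?ltr0n // div1r -powRN.
by rewrite ler_piMl ?powR_ge0.
Unshelve. all: by end_near. Qed.

Local Open Scope classical_set_scope.
Local Open Scope ring_scope.

Theorem theorem1p5 (R : realType) (r : nat) (V : finType) (F : r_graph r V)
    (p : nat -> R) :
  (2 <= r)%N ->
  (2 <= nb_edges F)%N ->
  threshold_exponent R F < r%:R ->
  (forall n : nat, 0 <= p n <= 1) ->
  (forall n : nat, (0 < n)%N -> n%:R `^ (- threshold_exponent R F) <= p n) ->
  exists eps : nat -> R,
    eps n @[n --> \oo] --> (0 : R) /\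
    Gnp_prob (p n)
      [set G : r_graph r 'I_n |
        n%:R `^ (r%:R - threshold_exponent R F - eps n)
          * (p n * n%:R `^ threshold_exponent R F) `^ gap_exponent R F
        <= (turan_ex G F)%:R]%SET @[n --> \oo] --> (1 : R).
Proof.
move=> r2 e2 mr p01 pm.
have := turan_bound_eventually r2 e2 mr p01 pm.
apply: (@diagonal_cvg1 R (fun n d => Gnp_prob (p n) _)) => n d.
by rewrite Gnp_prob_ge0 // Gnp_prob_le1.
Qed.
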